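(* Let $n\ge1$, let $X_1,\ldots,X_n,Z$ be random variables with any joint distribution taking values in the set of non-negative integers, let $\bar F_i(s)=P(X_i>s)$ for $i=1,\ldots,n$, $\bar G(s)=P(Z>s)$, and $T=X_{n:n}+Z$. Let $Y$ be a random variable with $P(Y>y)=\max_{i=1,\ldots,n}P(X_i>y)$ for all $y$, and assume $E\,Y<\infty$ and $E\,Z<\infty$. Let $t$ be a non-negative integer with $P(T>t)>0$ and fix $d>0$. If the non-negative integer $t_0$ satisfies $$\sum_{s=[(t_0+1)/2]}^{\infty}\bar G(s)\le\frac14\,d\,P(T>t)\qquad\text{and}\qquad\sum_{s=[(t_0+1)/2]}^{\infty}\max_{i=1,\ldots,n}\bar F_i(s)\le\frac{d\,P(T>t)}{4(2^n-1)},$$ where $[x]$ denotes the integer part of $x$, then the approximation $$E(T-t\mid T>t)\approx\frac1{P(T>t)}\sum_{s=t}^{t_0}P(T>s)$$ has error not greater than $d$ (in absolute value).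
   Context: $X_{n:n}=\max(X_1,\ldots,X_n)$. $T$ is the lifetime of a parallel ($1$-out-of-$n$) system with active component lifetimes $X_1,\ldots,X_n$ and one cold standby unit with lifetime $Z$. Empty sums are $0$. *)

(* Defs.v *)
From HB Require Import structures.
From mathcomp Require Import all_boot all_order all_algebra.
From mathcomp Require Import all_classical all_reals all_analysis.

Set Implicit Arguments.
Unset Strict Implicit.
Unset Printing Implicit Defensive.

Import Order.TTheory GRing.Theory Num.Theory.
Import numFieldNormedType.Exports.

Local Open Scope classical_set_scope.
Local Open Scope ring_scope.
Local Open Scope ereal_scope.

Section Defs.
Context (d : measure_display) (Omega : measurableType d) (R : realType)
  (P : probability Omega R).

(* The counterpart of [ccdf] for variables with values in nat. *)
Definition survival (X : Omega -> nat) (s : nat) : \bar R :=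
  P [set w | (s < X w)%N].

(* E(f | A) for an event A of positive probability, as an extended real;
   the value is meaningless when P A = 0. *)
Definition cond_expectation (f : Omega -> R) (A : set Omega) : \bar R :=
  (\int[P]_(w in A) (f w)%:E) / P A.

End Defs.

(* X_{n:n}; for n = 0 the empty maximum is 0. *)
Definition max_lifetime (Omega : Type) (n : nat) (X : 'I_n -> Omega -> nat)
    (w : Omega) : nat :=
  \max_(i < n) X i w.

(* The lifetime of a parallel system with components X and one cold standby
   unit Z. *)
Definition standby_lifetime (Omega : Type) (n : nat) (X : 'I_n -> Omega -> nat)
    (Z : Omega -> nat) (w : Omega) : nat :=
  (max_lifetime X w + Z w)%N.

(* Main.v *)
(* E(T - t; T > t) is the sum of P(T > s) over s >= t, so the error is at most
   the sum of P(T > s) over s > t0, divided by P(T > t). If T > s then X_{n:n}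
   or Z exceeds [s/2]; each value k = [s/2] arises from at most two s, hence the
   tail is at most twice the sum over k >= [(t0+1)/2] of P(X_{n:n} > k) and
   P(Z > k). The union bound gives P(X_{n:n} > k) <= n max_i P(X_i > k), and
   n <= 2^n - 1. *)

Require Import Defs.
From HB Require Import structures.
From mathcomp Require Import all_boot all_order all_algebra.
From mathcomp Require Import all_classical all_reals all_analysis.
From mathcomp Require Import measurable_realfun ring lra.
Import Order.TTheory GRing.Theory Num.Theory.
Import numFieldNormedType.Exports.
Local Open Scope classical_set_scope.
Local Open Scope ring_scope.
Local Open Scope ereal_scope.

Section tail_sums.
Context {R : realType}.
Implicit Types u : (\bar R)^nat.

Lemma nneseries_le_bound {u} {m : nat} {x : \bar R} :
  (forall k, 0 <= u k) -> (forall N, \sum_(m <= k < N) u k <= x) ->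
  \sum_(m <= k <oo) u k <= x.
Proof.
move=> u0 ux; apply: lime_le; first exact: is_cvg_nneseries.
by apply: nearW.
Qed.

(** The indices with half [k] are exactly [k.*2] and [k.*2.+1]; even endpoints keep these pairs
    whole. *)
Lemma sum_half_nat u K N :
  \sum_(K.*2 <= s < (K + N).*2) u s./2 = \sum_(K <= k < K + N) (u k + u k).
Proof.
elim: N => [|N IH]; first by rewrite addn0 !big_geq.
rewrite addnS doubleS !big_nat_recr ?leq_addr//=; last 2 first.
- by rewrite leq_double leq_addr.
- by rewrite leqW// leq_double leq_addr.
by rewrite IH doubleK uphalf_double addeA.
Qed.

Lemma nneseries_half_le u m : (forall k, 0 <= u k) ->
  \sum_(m <= s <oo) u s./2 <= 2%:E * \sum_(m./2 <= k <oo) u k.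
Proof.
move=> u0; have u20 k : 0 <= u k./2 by [].
rewrite -nneseriesZl//; apply: nneseries_le_bound => // N.
have [Nm|mN] := leqP N m.
  by rewrite big_geq//; apply: nneseries_ge0 => k _ _; exact: mule_ge0.
(* The range from [m] to [N] is enlarged to one with even endpoints [K.*2] and [(K + N).*2], so that
   [sum_half_nat] applies; the added terms are nonnegative. *)
set K := m./2.
have Km : (K.*2 <= m)%N by rewrite -[leqRHS]odd_double_half leq_addl.
have KN : (N <= (K + N).*2)%N.
  by rewrite doubleD (leq_trans _ (leq_addl _ _))// -addnn leq_addr.
apply: (@le_trans _ _ (\sum_(K.*2 <= s < (K + N).*2) u s./2)).
  rewrite [leRHS](big_cat_nat Km)/=; last by rewrite (leq_trans (ltnW mN)).
  rewrite [X in _ + X](big_cat_nat (ltnW mN) KN)/=.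
  by rewrite addeCA leeDl// adde_ge0// sume_ge0.
rewrite sum_half_nat; apply: le_trans (nneseries_lim_ge (K + N) _); last first.
  by move=> k _ _; exact: mule_ge0.
by apply: lee_sum => k _; rewrite -mule2n mule_natl.
Qed.

End tail_sums.

Section survival.
Context {d : measure_display} {Omega : measurableType d} {R : realType}.
Context (P : probability Omega R).
Implicit Types T : Omega -> nat.

Lemma measurable_gtn {T} s : measurable_fun setT T ->
  measurable [set w | (s < T w)%N].
Proof.
by move=> mT; have := mT measurableT [set k | (s < k)%N] I; rewrite setTI.
Qed.

Lemma measurable_bigmaxn {I : Type} (r : seq I) {X : I -> Omega -> nat} :
  (forall i, measurable_fun setT (X i)) ->
  measurable_fun setT (fun w => \max_(i <- r) X i w).
Proof.
move=> mX; elim: r => [|i r IH].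
  by under eq_fun do rewrite big_nil; exact: measurable_cst.
by under eq_fun do rewrite big_cons; exact: measurable_fun_maxn.
Qed.

Lemma survival_ge0 T s : 0 <= survival P T s.
Proof. exact: measure_ge0. Qed.

(** The excess counts the [s] with [t + s < a]. Written as a series of indicators, it can be
    integrated term by term. *)
Lemma natr_sub_eseries {a t : nat} : (t < a)%N ->
  (a%:R - t%:R)%:E = \sum_(s <oo) ((t + s < a)%N%:R)%:E :> \bar R.
Proof.
move=> ta; have h0 s : 0 <= ((t + s < a)%N%:R)%:E :> \bar R.
  by rewrite lee_fin.
rewrite (@nneseries_split _ _ 0 (a - t))// add0n.
rewrite [X in _ + X]eseries0 ?adde0; last first.
  move=> s; rewrite leq_subLR => + _; rewrite leqNgt.
  by move=> /negbTE ->.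
rewrite (@eq_big_nat _ _ _ _ _ _ (fun=> 1)); last first.
  by move=> s /=; rewrite ltn_subRL => ->.
by rewrite sumEFin sumr_const_nat subn0 natrB// ltnW.
Qed.

(** Tail-sum formula: the terms are nonnegative, so sum and integral may be exchanged, and each
    indicator integrates to a survival probability. Both sides may be infinite. *)
Lemma integral_excess T t : measurable_fun setT T ->
  \int[P]_(w in [set w | (t < T w)%N]) ((T w)%:R - t%:R)%:E
  = \sum_(t <= s <oo) survival P T s.
Proof.
move=> mT; have mA s := measurable_gtn s mT.
have indE s : (fun w => ((t + s < T w)%N%:R)%:E : \bar R)
    = (fun w => (\1_[set w | (t + s < T w)%N] w)%:E).
  by apply/funext => w; rewrite indicE mem_setE.
under eq_integral => w.
  rewrite inE/= => tT; rewrite natr_sub_eseries//; over.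
rewrite integral_nneseries//; last first.
  move=> s; rewrite indE; apply: measurable_funTS.
  by apply/measurable_EFinP; exact: measurable_indic.
rewrite -nneseries_addn; last by move=> s; exact: survival_ge0.
apply: eq_eseriesr => s _.
rewrite indE integral_indic// /survival addnC; congr (P _).
(* The event [t + s < T w] already lies inside the domain of integration [t < T w]. *)
apply/seteqP; split => w /=; first by case.
by move=> h; split => //; apply: leq_ltn_trans h; rewrite leq_addl.
Qed.

(** Union bound, by induction on the list; the empty maximum is 0 and never exceeds [s]. *)
Lemma survival_bigmaxn_le {I : Type} (r : seq I) {X : I -> Omega -> nat} s :
  (forall i, measurable_fun setT (X i)) ->
  survival P (fun w => \max_(i <- r) X i w) s
  <= \sum_(i <- r) survival P (X i) s.
Proof.
move=> mX; elim: r => [|i r IH].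
  rewrite big_nil /survival (_ : [set w | _] = set0) ?measure0//.
  by apply/seteqP; split => w //=; rewrite big_nil.
rewrite big_cons (le_trans _ (leeD2l _ IH))//.
rewrite /survival (_ : [set w | _] =
    [set w | (s < X i w)%N] `|` [set w | (s < \max_(i <- r) X i w)%N]).
  apply: measureU2; apply: measurable_gtn => //; exact: measurable_bigmaxn.
by apply/seteqP; split => w /=; rewrite big_cons leq_max => /orP.
Qed.

Lemma survival_max_lifetime_le n {X : 'I_n -> Omega -> nat} s :
  (forall i, measurable_fun setT (X i)) ->
  survival P (max_lifetime X) s
  <= n%:R%:E * \big[maxe/0]_(i < n) survival P (X i) s.
Proof.
move=> mX; apply: le_trans (survival_bigmaxn_le _ s mX) _.
apply: (@le_trans _ _ (\sum_(i < n) \big[maxe/0]_(j < n) survival P (X j) s)).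
  by apply: lee_sum => i _; exact: le_bigmax.
by rewrite sumr_const card_ord mule_natl.
Qed.

(** If both variables are at most [s./2], their sum is at most [s./2.*2], hence at most [s]. *)
Lemma survival_add_le {T U : Omega -> nat} s :
  measurable_fun setT T -> measurable_fun setT U ->
  survival P (fun w => T w + U w)%N s
  <= survival P T s./2 + survival P U s./2.
Proof.
move=> mT mU.
have mTU := measurable_gtn s (measurable_fun_addn mT mU).
apply: le_trans (measureU2 _ (measurable_gtn _ mT) (measurable_gtn _ mU)).
apply: le_measure; rewrite ?inE//.
  by apply: measurableU; exact: measurable_gtn.
move=> w /=; case: (leqP (T w) s./2) => [Ts|]; last by left.
case: (leqP (U w) s./2) => [Us|]; last by right.
move: (leq_add Ts Us); rewrite addnn => /leq_trans le_s.
rewrite ltnNge le_s//.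
by rewrite -[leqRHS]odd_double_half leq_addl.
Qed.

End survival.

Theorem proposition3p3 (R : realType)
    (disp : measure_display) (Omega : measurableType disp)
    (P : probability Omega R)
    (n : nat) (hn : (1 <= n)%N)
    (X : 'I_n -> {RV P >-> nat}) (Z : {RV P >-> nat})
    (dispY : measure_display) (OmegaY : measurableType dispY)
    (PY : probability OmegaY R) (Y : {RV PY >-> R})
    (hY : forall y : R,
       PY [set w | (y < Y w)%R] =
       \big[maxe/0]_(i < n) P [set w | (y < (X i w)%:R)%R])
    (hEY : 'E_PY[Y] < +oo)
    (hEZ : 'E_P[fun w => (Z w)%:R] < +oo)
    (t : nat) (d : R) (hd : (0 < d)%R) (t0 : nat) :
  let T : Omega -> nat := standby_lifetime (fun i => X i : Omega -> nat) Z in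
  0 < survival P T t ->
  \sum_((t0 + 1) %/ 2 <= s <oo) survival P Z s
    <= (1 / 4 * d)%:E * survival P T t ->
  \sum_((t0 + 1) %/ 2 <= s <oo) \big[maxe/0]_(i < n) survival P (X i) s
    <= d%:E * survival P T t / (4 * (2 ^+ n - 1))%:E ->
  `| cond_expectation P (fun w => (T w)%:R - t%:R)%R [set w | (t < T w)%N]
     - (survival P T t)^-1 * \sum_(t <= s < t0.+1) survival P T s | <= d%:E.
Proof.
move=> T pT hZ hX.
have mX i : measurable_fun setT (X i : Omega -> nat) by exact: measurable_funPT.
have mZ : measurable_fun setT (Z : Omega -> nat) by exact: measurable_funPT.
have mM : measurable_fun setT (max_lifetime (fun i => X i : Omega -> nat)).
  exact: measurable_bigmaxn.
have mT : measurable_fun setT T by exact: measurable_fun_addn.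
have sT0 s : 0 <= survival P T s by exact: survival_ge0.
have sZ0 s : 0 <= survival P Z s by exact: survival_ge0.
pose F s := \big[maxe/0]_(i < n) survival P (X i) s.
have F0 s : 0 <= F s by exact: bigmax_ge_id.
rewrite /cond_expectation integral_excess//.
rewrite -[P [set w | _]]/(survival P T t).
have [p p0 pE] : exists2 p : R, (0 < p)%R & survival P T t = p%:E.
  have fp : survival P T t \is a fin_num.
    by apply: fin_num_measure; exact: measurable_gtn.
  exists (fine (survival P T t)); last by rewrite fineK.
  by rewrite fine_gt0// pT ltey_eq fp.
move: hZ hX; rewrite pE.
(* Here [n >= 1] enters. The inverse in [\bar R] treats 0 separately, so nonzero denominators are
   required before passing to real inverses. *)
have c0 : (0 < 4 * (2 ^+ n - 1) :> R)%R.
  by rewrite mulr_gt0// subr_gt0 exprn_egt1 ?ltr1n -?lt0n.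
rewrite !inver (gt_eqF c0) (gt_eqF p0) -!EFinM !addn1 divn2 => hZ hX.
(* This is the error bound multiplied by [p]. The lower index [t0.+1./2] of the hypotheses is the
   one that [nneseries_half_le] yields for a tail starting at [t0.+1]. *)
have tail : \sum_(t0.+1 <= s <oo) survival P T s <= (d * p)%:E.
  pose u k := n%:R%:E * F k + survival P Z k.
  have nF0 k : 0 <= n%:R%:E * F k by rewrite mule_ge0// lee_fin.
  have u0 k : 0 <= u k by rewrite adde_ge0.
  apply: (@le_trans _ _ (\sum_(t0.+1 <= s <oo) u s./2)).
    apply: lee_nneseries => // s _.
    apply: le_trans (survival_add_le P s mM mZ) _.
    by rewrite leeD2r// survival_max_lifetime_le.
  apply: le_trans (nneseries_half_le u t0.+1 u0) _.
  rewrite nneseriesD// nneseriesZl//.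
  apply: (@le_trans _ _ (2%:E *
      (n%:R%:E * (d * p / (4 * (2 ^+ n - 1)))%:E + (1 / 4 * d * p)%:E))).
    by rewrite lee_pmul2l// leeD// lee_wpmul2l// lee_fin.
  rewrite -!EFinM lee_fin.
  have n2 : (n%:R <= 2 ^+ n - 1 :> R)%R.
    by rewrite lerBrDr -natrX natr1 ler_nat ltn_expl.
  have k0 : (0 < 2 ^+ n - 1 :> R)%R by rewrite pmulr_rgt0 in c0.
  (* The components and the standby unit thus contribute at most [d * p / 4] each, and the factor 2
     from halving the index brings the total to [d * p]. *)
  have : (n%:R * (d * p / (4 * (2 ^+ n - 1))) <= d * p / 4)%R.
    rewrite mulrA ler_pdivrMr//.
    rewrite (_ : d * p / 4 * _ = d * p * (2 ^+ n - 1))%R; last by field.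
    by rewrite mulrC ler_pM2l// mulr_gt0.
  by lra.
(* Starting at [maxn t t0.+1] covers the case t0 < t, where the approximating
   sum is empty. *)
have {tail} : \sum_(maxn t t0.+1 <= s <oo) survival P T s <= (d * p)%:E.
  apply: le_trans tail.
  rewrite [leRHS](nneseries_split t0.+1 (maxn t t0.+1 - t0.+1))//.
  by rewrite subnKC ?leq_maxr// leeDr// sume_ge0.
have -> : \sum_(t <= s < t0.+1) survival P T s =
    \sum_(t <= s < maxn t t0.+1) survival P T s.
  by have [h|//] := leqP t0.+1 t; rewrite !big_geq.
rewrite (nneseries_split t (maxn t t0.+1 - t))// subnKC ?leq_maxl//.
set S := \sum_(_ <= s < _) _; set Q := \sum_(_ <= s <oo) _ => Qd.
(* Finiteness of [S] allows [S / p] to be cancelled in [\bar R]; the error left is [Q / p], whose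
   sign removes the absolute value. *)
have S_fin : S \is a fin_num.
  by apply/sum_fin_numP => s _ _; apply: fin_num_measure; exact: measurable_gtn.
have Q0 : 0 <= Q by exact: nneseries_ge0.
rewrite ge0_muleDl ?sume_ge0// (muleC _ S) addeAC subee ?fin_numM// add0e.
rewrite gee0_abs; last by rewrite mule_ge0// lee_fin invr_ge0 ltW.
by rewrite lee_pdivrMr.
Qed.
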